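(* Let $V$ be a finite dimensional real vector space with a non-degenerate symmetric bilinear form $(\cdot,\cdot)$ of signature $(p,q)$, and let $J$ be a pseudo-Hermitian almost complex structure on $V$. Let $\phi:V\to V$ be a linear map with $J\phi=\phi J$ and $\phi^*=\pm\phi$. Then $R=R_\phi$ satisfies, for all $x,y,z,w\in V$, $$\begin{aligned}R(x,y,z,w)+R(Jx,Jy,Jz,Jw)&=R(Jx,Jy,z,w)+R(Jx,y,Jz,w)+R(Jx,y,z,Jw)\\&\quad+R(x,Jy,Jz,w)+R(x,Jy,z,Jw)+R(x,y,Jz,Jw).\end{aligned}$$
   Context: A pseudo-Hermitian almost complex structure $J$ on $V$ is a linear isometry of $(V,(\cdot,\cdot))$ with $J^2=-\mathrm{Id}$. The adjoint $\phi^*$ of a linear map $\phi$ of $V$ is defined by $(\phi v,w)=(v,\phi^*w)$ for all $v,w\in V$; $\phi$ is self-adjoint if $\phi^*=\phi$ and skew-adjoint if $\phi^*=-\phi$. If $\phi$ is self-adjoint, define $R_\phi(x,y,z,w):=(\phi y,z)(\phi x,w)-(\phi x,z)(\phi y,w)$. If $\phi$ is skew-adjoint, define $R_\phi(x,y,z,w):=(\phi y,z)(\phi x,w)-(\phi x,z)(\phi y,w)-2(\phi x,y)(\phi z,w)$. *)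

(* Defs.v *)
From HB Require Import structures.
From mathcomp Require Import all_boot all_order all_algebra.
From mathcomp Require Import boolp classical_sets reals.

Set Implicit Arguments.
Unset Strict Implicit.
Unset Printing Implicit Defensive.

Import Order.TTheory GRing.Theory Num.Theory.
Local Open Scope ring_scope.

(* Convention for signature (p, q): p timelike (negative) and q spacelike
   (positive) directions. *)
Definition has_signature (R : realType) (V : vectType R) (form : {symmetric V})
    (p q : nat) : Prop :=
  exists2 e : (p + q).-tuple V, basis_of {:V} e &
    forall i j : 'I_(p + q), form (tnth e i) (tnth e j) =
      if i == j then (if (i < p)%N then -1 else 1) else 0.

Definition is_pseudo_hermitian (R : realType) (V : vectType R)
    (form : {symmetric V}) (J : 'End(V)) : Prop :=
  isometry form form J /\ (J \o J)%VF = - \1%VF.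

Definition is_adjoint (R : realType) (V : vectType R) (form : {symmetric V})
    (phi psi : 'End(V)) : Prop :=
  forall v w : V, form (phi v) w = form v (psi w).

(* For a nondegenerate form this is the unique linear map with the defining
   property, see adjointP and adjoint_unique. The value 0 is only a default. *)
Definition adjoint (R : realType) (V : vectType R) (form : {symmetric V})
    (phi : 'End(V)) : 'End(V) :=
  xget 0 [set psi | is_adjoint form phi psi].

Definition self_adjoint (R : realType) (V : vectType R) (form : {symmetric V})
    (phi : 'End(V)) : Prop := adjoint form phi = phi.

Definition skew_adjoint (R : realType) (V : vectType R) (form : {symmetric V})
    (phi : 'End(V)) : Prop := adjoint form phi = - phi.

(* The third branch is never used: R_phi is only considered for phi^* = +-phi.
   If phi is both self-adjoint and skew-adjoint then phi = 0 and the first two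
   branches agree, see curv_skew. *)
Definition curv (R : realType) (V : vectType R) (form : {symmetric V})
    (phi : 'End(V)) (x y z w : V) : R :=
  if adjoint form phi == phi then
    form (phi y) z * form (phi x) w - form (phi x) z * form (phi y) w
  else if adjoint form phi == - phi then
    form (phi y) z * form (phi x) w - form (phi x) z * form (phi y) w
    - 2 * (form (phi x) y * form (phi z) w)
  else 0.

Section AdjointTheory.
Variables (R : realType) (V : vectType R) (form : {symmetric V}).
Hypothesis form_nondeg : nondegenerate form.

Lemma nondegenerateP (u : V) : (forall v, form v u = 0) -> u = 0.
Proof.
move=> u0; apply/eqP; rewrite -memv0 -(eqP form_nondeg).
apply/mem_orthovP => v _.
by rewrite hermC u0 rmorph0 mulr0.
Qed.

Lemma adjoint_unique (phi psi1 psi2 : 'End(V)) :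
  is_adjoint form phi psi1 -> is_adjoint form phi psi2 -> psi1 = psi2.
Proof.
move=> h1 h2; apply/lfunP => w; apply/eqP; rewrite -subr_eq0; apply/eqP.
by apply: nondegenerateP => v; rewrite linearBr/= -(h1 v w) -(h2 v w) subrr.
Qed.

Let n := \dim {:V}.
Let b := vbasis {:V}.

Let row_of (phi : 'End(V)) (w : V) : 'rV[R]_n :=
  \row_(i < n) form (phi b`_i) w.

Let row_of_linear phi : linear (row_of phi).
Proof.
by move=> a u v; apply/rowP => i; rewrite !mxE linearPr.
Qed.

HB.instance Definition _ phi :=
  GRing.isLinear.Build R V 'rV[R]_n _ (row_of phi) (row_of_linear phi).

Let row_ofP phi psi w : row_of phi w = row_of \1%VF (psi w) ->
  forall v, form (phi v) w = form v (psi w).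
Proof.
move=> /rowP h v; rewrite (coord_vbasis (memvf v)) linear_sum.
rewrite !linear_sumlz; apply: eq_bigr => i _.
rewrite linearZ/= !linearZl_LR/=; congr (_ * _).
by have := h i; rewrite !mxE id_lfunE.
Qed.

Lemma adjointP (phi : 'End(V)) : is_adjoint form phi (adjoint form phi).
Proof.
pose F := linfun (row_of \1%VF).
have kF : lker F == 0%VS.
  apply/lker0P => u v; rewrite !lfunE/= => uv.
  apply/eqP; rewrite -subr_eq0; apply/eqP; apply: nondegenerateP => x.
  rewrite -(@row_ofP 0 (fun=> u - v) 0) ?zero_lfunE ?linear0l//.
  by rewrite linear0 linearB/= uv subrr.
  have fF : limg F = fullv.
  apply/eqP; rewrite eqEdim subvf/= limg_dim_eq; last first.
    by rewrite (eqP kF) capv0.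
  by rewrite !dimvf /dim/= mul1n /n dimvf.
apply: (@xgetPex _ _ [set psi | is_adjoint form phi psi]).
exists (F^-1 \o linfun (row_of phi))%VF => v w.
apply: row_ofP; rewrite comp_lfunE [in RHS]lfunE/=.
have := @limg_lfunVK _ _ _ F (row_of phi w).
by rewrite fF memvf lfunE/= => ->.
Qed.

Lemma adjointE (phi psi : 'End(V)) :
  adjoint form phi = psi <-> is_adjoint form phi psi.
Proof.
split=> [<-|]; first exact: adjointP.
exact: adjoint_unique (adjointP _).
Qed.

Lemma curv_self (phi : 'End(V)) : self_adjoint form phi -> forall x y z w : V,
  curv form phi x y z w =
    form (phi y) z * form (phi x) w - form (phi x) z * form (phi y) w.
Proof. by move=> h x y z w; rewrite /curv h eqxx. Qed.

Lemma curv_skew (phi : 'End(V)) : skew_adjoint form phi -> forall x y z w : V,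
  curv form phi x y z w =
    form (phi y) z * form (phi x) w - form (phi x) z * form (phi y) w
    - 2 * (form (phi x) y * form (phi z) w).
Proof.
move=> h x y z w; rewrite /curv h eqxx; case: eqP => // phiN.
have -> : phi = 0.
  apply/eqP; have /eqP : (2 : R) *: phi = 0
    by rewrite scaler_nat mulr2n -{1}phiN addNr.
  by rewrite scaler_eq0 pnatr_eq0.
by rewrite !zero_lfunE !linear0l !mul0r !mulr0 !subr0.
Qed.

End AdjointTheory.

(* Main.v *)
Require Import Defs.
From mathcomp Require Import all_boot all_order all_algebra.
From mathcomp Require Import reals ring.
Set Implicit Arguments.
Unset Strict Implicit.
Unset Printing Implicit Defensive.
Import Order.TTheory GRing.Theory Num.Theory.
Local Open Scope ring_scope.

(* Write B(x, y) = (phi x, y). Since J is isometric and commutes with phi, B is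
   J-invariant, and J^2 = -1 then gives B(x, J y) = - B(J x, y). Every summand
   of R_phi is a product of two values of B which together use x, y, z, w once
   each, and each such product satisfies the asserted identity separately. *)

Section PseudoHermitianInvariance.
Variables (R : realType) (V : vectType R) (form : {symmetric V}).
Variables J phi : 'End(V).
Hypothesis J_herm : is_pseudo_hermitian form J.
Hypothesis J_phi : (J \o phi)%VF = (phi \o J)%VF.

Lemma form_phi_JJ x y : form (phi (J x)) (J y) = form (phi x) y.
Proof.
case: J_herm => J_isom _.
by rewrite -[phi (J x)]comp_lfunE -J_phi comp_lfunE J_isom.
Qed.

Lemma form_phi_Jr x y : form (phi x) (J y) = - form (phi (J x)) y.
Proof.
have /lfunP/(_ y) := J_herm.2; rewrite comp_lfunE opp_lfunE id_lfunE => JJy.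
(* Invariance read backwards applies [J] to both slots, and the second becomes [J (J y) = - y]. *)
by rewrite -form_phi_JJ JJy linearNr.
Qed.

End PseudoHermitianInvariance.

Theorem theorem3 (R : realType) (V : vectType R) (form : {symmetric V})
    (p q : nat) (form_nondeg : nondegenerate form)
    (form_sign : has_signature form p q)
    (J : 'End(V)) (J_herm : is_pseudo_hermitian form J)
    (phi : 'End(V)) (J_phi : (J \o phi)%VF = (phi \o J)%VF)
    (phi_adj : self_adjoint form phi \/ skew_adjoint form phi) :
  forall x y z w : V,
    curv form phi x y z w + curv form phi (J x) (J y) (J z) (J w) =
      curv form phi (J x) (J y) z w + curv form phi (J x) y (J z) w
      + curv form phi (J x) y z (J w) + curv form phi x (J y) (J z) w
      + curv form phi x (J y) z (J w) + curv form phi x y (J z) (J w).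
Proof.
move=> x y z w; case: phi_adj => phiE.
  (* For each product, two [J] in one factor cancel, so two of the six right-hand terms return the
     product; the other four, with one [J] per factor, cancel in sign. *)
  rewrite !(curv_self phiE) !(form_phi_JJ J_herm J_phi).
  by rewrite !(form_phi_Jr J_herm J_phi); ring.
(* The extra product pairs [x] with [y] and [z] with [w]; the same count applies. *)
rewrite !(curv_skew phiE) !(form_phi_JJ J_herm J_phi).
by rewrite !(form_phi_Jr J_herm J_phi); ring.
Qed.
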